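(* (1) Let $\mathcal{A}=(A,\mu,\alpha_A)$ be a Hom-alternative algebra of alternative type with $\mathcal{A}'=(A,\mu')$ its induced alternative algebra, and let $(V,\alpha_V)$ be a Hom-alternative $\mathcal{A}$-bimodule with structure maps $\rho_l$ and $\rho_r$ such that $\alpha_V$ is invertible. Then $V$ is an alternative $\mathcal{A}'$-bimodule with the structure maps $\delta_l=\alpha_V^{-1}\circ\rho_l$ and $\delta_r=\alpha_V^{-1}\circ\rho_r$. (2) Let $\mathcal{A}'=(A,\mu')$ be an alternative algebra and $\mathcal{A}=(A,\mu=\alpha_A\circ\mu',\alpha_A)$ a corresponding Hom-alternative algebra, where $\alpha_A$ is a morphism of $(A,\mu')$. Let $V$ be an alternative $\mathcal{A}'$-bimodule with structure maps $\delta_l$ and $\delta_r$, and let $\alpha_V\in \mathrm{End}(V)$ be such that $\alpha_V\circ\delta_l=\delta_l\circ(\alpha_A\otimes\alpha_V)$ and $\alpha_V\circ\delta_r=\delta_r\circ(\alpha_V\otimes\alpha_A)$. Then $(V,\alpha_V)$ is a Hom-alternative $\mathcal{A}$-bimodule with the structure maps $\rho_l=\alpha_V\circ\delta_l$ and $\rho_r=\alpha_V\circ\delta_r$.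
   Context: All vector spaces are over a fixed field $\mathbb{K}$ of characteristic $0$. A Hom-algebra is a triple $(A,\mu,\alpha)$ with $A$ a vector space, $\mu:A\otimes A\to A$ linear (written $ab=\mu(a,b)$) and $\alpha:A\to A$ linear; it is multiplicative if $\alpha\circ\mu=\mu\circ(\alpha\otimes\alpha)$. A Hom-alternative algebra is a multiplicative Hom-algebra such that $as_A(x,y,z)=\mu(\mu(x,y),\alpha(z))-\mu(\alpha(x),\mu(y,z))$ satisfies $as_A(x,x,y)=0=as_A(x,y,y)$ for all $x,y\in A$. It is of alternative type if there is an alternative algebra $(A,\mu')$ with $\mu=\alpha\circ\mu'$; $(A,\mu')$ is then called its induced (compatible) alternative algebra. Alternative bimodule: for an alternative algebra $\mathcal{A}'=(A,\mu')$, an alternative $\mathcal{A}'$-bimodule is a vector space $V$ with linear structure maps $\delta_l:A\otimes V\to V$, $a\otimes v\mapsto a\cdot v$, and $\delta_r:V\otimes A\to V$, $v\otimes a\mapsto v\cdot a$, such that $(a,v,b)=-(v,a,b)=(b,a,v)=-(a,b,v)$ for all $a,b\in A$, $v\in V$, where $(v,a,b)=(v\cdot a)\cdot b-v\cdot\mu'(a,b)$, $(a,v,b)=(a\cdot v)\cdot b-a\cdot(v\cdot b)$, $(a,b,v)=\mu'(a,b)\cdot v-a\cdot(b\cdot v)$. Hom-alternative bimodule: for a Hom-alternative algebra $\mathcal{A}=(A,\mu,\alpha_A)$, a Hom-alternative $\mathcal{A}$-bimodule is a vector space $V$ with a linear map $\alpha_V:V\to V$ and structure maps $\rho_l:A\otimes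 V\to V$, $a\otimes v\mapsto a\cdot v$, and $\rho_r:V\otimes A\to V$, $v\otimes a\mapsto v\cdot a$, which are morphisms of Hom-modules, i.e. linear with $\alpha_V\circ\rho_l=\rho_l\circ(\alpha_A\otimes\alpha_V)$ and $\alpha_V\circ\rho_r=\rho_r\circ(\alpha_V\otimes\alpha_A)$, such that $as_{A,V}(a,v,b)=-as_{A,V}(v,a,b)=as_{A,V}(b,a,v)=-as_{A,V}(a,b,v)$ for all $a,b\in A$, $v\in V$, where $as_{A,V}(v,a,b)=(v\cdot a)\cdot\alpha_A(b)-\alpha_V(v)\cdot\mu(a,b)$, $as_{A,V}(a,v,b)=(a\cdot v)\cdot\alpha_A(b)-\alpha_A(a)\cdot(v\cdot b)$, $as_{A,V}(a,b,v)=\mu(a,b)\cdot\alpha_V(v)-\alpha_A(a)\cdot(b\cdot v)$. *)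

(* Defs.v *)
From HB Require Import structures.
From mathcomp Require Import all_boot all_order all_algebra.

Set Implicit Arguments.
Unset Strict Implicit.
Unset Printing Implicit Defensive.

Import GRing.Theory.
Local Open Scope ring_scope.

(* Vector spaces over K have arbitrary dimension ([lmodType K]). A linear map
   out of a tensor product U (x) W is encoded as the bilinear map on U, W that
   corresponds to it. *)

Definition associator (A : zmodType) (mu : A -> A -> A) (x y z : A) : A :=
  mu (mu x y) z - mu x (mu y z).

Definition hom_associator (A : zmodType) (mu : A -> A -> A) (alpha : A -> A)
    (x y z : A) : A :=
  mu (mu x y) (alpha z) - mu (alpha x) (mu y z).

Record alternative_algebra (K : fieldType) (A : lmodType K) :=
  AlternativeAlgebra {
    alt_mul : {bilinear A -> A -> A};
    alt_left : forall x y : A, associator alt_mul x x y = 0;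
    alt_right : forall x y : A, associator alt_mul x y y = 0
  }.

Record hom_alternative_algebra (K : fieldType) (A : lmodType K) :=
  HomAlternativeAlgebra {
    hom_mul : {bilinear A -> A -> A};
    hom_twist : {linear A -> A};
    hom_multiplicative : forall x y : A,
      hom_twist (hom_mul x y) = hom_mul (hom_twist x) (hom_twist y);
    hom_alt_left : forall x y : A,
      hom_associator hom_mul hom_twist x x y = 0;
    hom_alt_right : forall x y : A,
      hom_associator hom_mul hom_twist x y y = 0
  }.

Definition is_induced_alternative (K : fieldType) (A : lmodType K)
    (H : hom_alternative_algebra A) (A' : alternative_algebra A) : Prop :=
  forall x y : A, hom_mul H x y = hom_twist H (alt_mul A' x y).

Definition of_alternative_type (K : fieldType) (A : lmodType K)
    (H : hom_alternative_algebra A) : Prop :=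
  exists A' : alternative_algebra A, is_induced_alternative H A'.

Definition is_alternative_morphism (K : fieldType) (A : lmodType K)
    (A' : alternative_algebra A) (f : {linear A -> A}) : Prop :=
  forall x y : A, f (alt_mul A' x y) = alt_mul A' (f x) (f y).

Section Bimodules.
Variables (K : fieldType) (A V : lmodType K).

Section Alternative.
Variables (A' : alternative_algebra A) (dl : A -> V -> V) (dr : V -> A -> V).

Definition alt_assoc_vab (v : V) (a b : A) : V :=
  dr (dr v a) b - dr v (alt_mul A' a b).
Definition alt_assoc_avb (a : A) (v : V) (b : A) : V :=
  dr (dl a v) b - dl a (dr v b).
Definition alt_assoc_abv (a b : A) (v : V) : V :=
  dl (alt_mul A' a b) v - dl a (dl b v).

Record is_alternative_bimodule : Prop := IsAlternativeBimodule {
  alt_bimod_bilinear_l : bilinear_for *:%R *:%R dl;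
  alt_bimod_bilinear_r : bilinear_for *:%R *:%R dr;
  alt_bimod_assoc : forall (a b : A) (v : V),
    [/\ alt_assoc_avb a v b = - alt_assoc_vab v a b,
        - alt_assoc_vab v a b = alt_assoc_abv b a v
      & alt_assoc_abv b a v = - alt_assoc_abv a b v]
}.
End Alternative.

Section HomAlternative.
Variables (H : hom_alternative_algebra A) (alphaV : {linear V -> V}).
Variables (rl : A -> V -> V) (rr : V -> A -> V).

Definition hom_assoc_vab (v : V) (a b : A) : V :=
  rr (rr v a) (hom_twist H b) - rr (alphaV v) (hom_mul H a b).
Definition hom_assoc_avb (a : A) (v : V) (b : A) : V :=
  rr (rl a v) (hom_twist H b) - rl (hom_twist H a) (rr v b).
Definition hom_assoc_abv (a b : A) (v : V) : V :=
  rl (hom_mul H a b) (alphaV v) - rl (hom_twist H a) (rl b v).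

Record is_hom_alternative_bimodule : Prop := IsHomAlternativeBimodule {
  hom_bimod_bilinear_l : bilinear_for *:%R *:%R rl;
  hom_bimod_bilinear_r : bilinear_for *:%R *:%R rr;
  hom_bimod_morph_l : forall (a : A) (v : V),
    alphaV (rl a v) = rl (hom_twist H a) (alphaV v);
  hom_bimod_morph_r : forall (v : V) (a : A),
    alphaV (rr v a) = rr (alphaV v) (hom_twist H a);
  hom_bimod_assoc : forall (a b : A) (v : V),
    [/\ hom_assoc_avb a v b = - hom_assoc_vab v a b,
        - hom_assoc_vab v a b = hom_assoc_abv b a v
      & hom_assoc_abv b a v = - hom_assoc_abv a b v]
}.
End HomAlternative.

End Bimodules.

(* Main.v *)
Require Import Defs.
From HB Require Import structures.
From mathcomp Require Import all_boot all_order all_algebra.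

Set Implicit Arguments.
Unset Strict Implicit.
Unset Printing Implicit Defensive.

Import GRing.Theory.
Local Open Scope ring_scope.

(** Untwisting the multiplication and the action by the twist maps turns each
Hom-associator into the second iterate of [alphaV] applied to the corresponding
ordinary associator.  Indeed, if [rl = alphaV \o dl], [rr = alphaV \o dr] and
[mu = alphaA \o mu'], every term of a Hom-associator of [(V, rl, rr)] carries
one outer [alphaV], and a second twist can be pulled out of its inner factors
because [dl] and [dr] are equivariant; for example
[[
  rr (rl a v) (alphaA b) = alphaV (dr (alphaV (dl a v)) (alphaA b))
                         = alphaV (alphaV (dr (dl a v) b)).
]]
Both directions follow from these identities, which are the lemmas
[hom_assoc_avbE], [hom_assoc_vabE] and [hom_assoc_abvE]: an alternative
bimodule yields a Hom-alternative one by applying the linear map [alphaV] twice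
to its defining relations, and when [alphaV] is invertible, hence injective,
it can be cancelled twice from the relations of a Hom-alternative bimodule.  In
that second case [dl] and [dr] are again equivariant: that [alphaV] is a
morphism of Hom-modules for [rl] means
[alphaV (alphaV (dl a v)) = alphaV (dl (alphaA a) (alphaV v))], and one [alphaV]
cancels. *)

Section Untwisting.
Variables (K : fieldType) (A V : lmodType K).
Variables (A' : alternative_algebra A) (H : hom_alternative_algebra A).
Variables (alphaV : {linear V -> V}).
Variables (dl rl : A -> V -> V) (dr rr : V -> A -> V).

Hypothesis induced : is_induced_alternative H A'.
Hypothesis rlE : forall a v, rl a v = alphaV (dl a v).
Hypothesis rrE : forall v a, rr v a = alphaV (dr v a).
Hypothesis dl_equivariant :
  forall a v, alphaV (dl a v) = dl (hom_twist H a) (alphaV v).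
Hypothesis dr_equivariant :
  forall v a, alphaV (dr v a) = dr (alphaV v) (hom_twist H a).

(** The relations between the two pairs of actions are pointwise hypotheses
rather than definitions, so that either pair can be the given one: [rl], [rr]
when [alphaV] is inverted, [dl], [dr] when it is applied.  Each term gets its
second [alphaV] from equivariance, which turns the twist of the remaining
argument into a twist of the whole product. *)
Lemma hom_assoc_avbE a v b :
  hom_assoc_avb H rl rr a v b = alphaV (alphaV (alt_assoc_avb dl dr a v b)).
Proof.
by rewrite /hom_assoc_avb /alt_assoc_avb !rlE !rrE !linearB /=
           -dr_equivariant -dl_equivariant.
Qed.

(** In the term [rr (alphaV v) (mu a b)] the factor [mu a b] is itself
[alphaA (mu' a b)], so equivariance applies to it as well. *)
Lemma hom_assoc_vabE v a b :
  hom_assoc_vab H alphaV rr v a b = alphaV (alphaV (alt_assoc_vab A' dr v a b)).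
Proof.
by rewrite /hom_assoc_vab /alt_assoc_vab induced !rrE !linearB /=
           -!dr_equivariant.
Qed.

Lemma hom_assoc_abvE a b v :
  hom_assoc_abv H alphaV rl a b v = alphaV (alphaV (alt_assoc_abv A' dl a b v)).
Proof.
by rewrite /hom_assoc_abv /alt_assoc_abv induced !rlE !linearB /=
           -!dl_equivariant.
Qed.

End Untwisting.

Lemma bilinear_comp (K : fieldType) (U W V : lmodType K) (g : V -> V)
    (f : U -> W -> V) :
  linear g -> bilinear_for *:%R *:%R f ->
  bilinear_for *:%R *:%R (fun u w => g (f u w)).
Proof.
by move=> g_lin [fl fr]; split=> [w k x y|u k x y] /=;
  rewrite -g_lin; congr g; [apply: fl | apply: fr].
Qed.

Theorem theorem5p5 (K : fieldType) (charK0 : [pchar K] =i pred0)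
    (A V : lmodType K) :
  (forall (H : hom_alternative_algebra A) (A' : alternative_algebra A)
      (alphaV : {linear V -> V}) (alphaV_inv : V -> V)
      (rl : A -> V -> V) (rr : V -> A -> V),
    of_alternative_type H ->
    is_induced_alternative H A' ->
    is_hom_alternative_bimodule H alphaV rl rr ->
    cancel alphaV alphaV_inv -> cancel alphaV_inv alphaV ->
    is_alternative_bimodule A'
      (fun a v => alphaV_inv (rl a v)) (fun v a => alphaV_inv (rr v a)))
  /\
  (forall (A' : alternative_algebra A) (H : hom_alternative_algebra A)
      (alphaV : {linear V -> V}) (dl : A -> V -> V) (dr : V -> A -> V),
    is_induced_alternative H A' ->
    is_alternative_morphism A' (hom_twist H) ->
    is_alternative_bimodule A' dl dr ->
    (forall (a : A) (v : V),
      alphaV (dl a v) = dl (hom_twist H a) (alphaV v)) ->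
    (forall (v : V) (a : A),
      alphaV (dr v a) = dr (alphaV v) (hom_twist H a)) ->
    is_hom_alternative_bimodule H alphaV
      (fun a v => alphaV (dl a v)) (fun v a => alphaV (dr v a))).
Proof.
split=> [H A' alphaV beta rl rr _ induced [rl_lin rr_lin rl_morph rr_morph rel]
          alphaK betaK
        |A' H alphaV dl dr induced _ [dl_lin dr_lin rel] dl_equiv dr_equiv].
- have beta_lin : linear beta.
    by move=> k x y; apply: (can_inj alphaK); rewrite linearP !betaK.
  have rlE a v : rl a v = alphaV (beta (rl a v)) by rewrite betaK.
  have rrE v a : rr v a = alphaV (beta (rr v a)) by rewrite betaK.
  have dl_equiv a v :
      alphaV (beta (rl a v)) = beta (rl (hom_twist H a) (alphaV v)).
    by rewrite -rl_morph alphaK betaK.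
  have dr_equiv v a :
      alphaV (beta (rr v a)) = beta (rr (alphaV v) (hom_twist H a)).
    by rewrite -rr_morph alphaK betaK.
  have alpha2_inj : injective (fun v => alphaV (alphaV v)).
    by move=> x y /(can_inj alphaK)/(can_inj alphaK).
  split; [exact: bilinear_comp | exact: bilinear_comp | move=> a b v].
  have := rel a b v.
  rewrite (hom_assoc_avbE rlE rrE dl_equiv dr_equiv).
  rewrite (hom_assoc_vabE induced rrE dr_equiv).
  rewrite !(hom_assoc_abvE induced rlE dl_equiv) -!linearN.
  by case=> /alpha2_inj eq1 /alpha2_inj eq2 /alpha2_inj eq3; split.
- have alphaV_lin : linear alphaV by exact: linearP.
  split; [exact: bilinear_comp | exact: bilinear_comp | | | move=> a b v].
  + by move=> a v; rewrite -dl_equiv.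
  + by move=> v a; rewrite -dr_equiv.
  have rlE a' v' : alphaV (dl a' v') = alphaV (dl a' v') by [].
  have rrE v' a' : alphaV (dr v' a') = alphaV (dr v' a') by [].
  rewrite (hom_assoc_avbE rlE rrE dl_equiv dr_equiv).
  rewrite (hom_assoc_vabE induced rrE dr_equiv).
  rewrite !(hom_assoc_abvE induced rlE dl_equiv) -!linearN.
  by case: (rel a b v) => -> -> ->.
Qed.
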